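(* Let $n\geq 3$ be an integer and let $p(z)=z^n+a_{n-1}z^{n-1}+a_{n-2}z^{n-2}+\ldots+a_1z+a_0$ be a monic polynomial with complex coefficients and $a_0\neq 0$. Set $a_{-1}=0$ and $b_j=a_{n-1}a_j-a_{j-1}$ for $j=0,1,2,\ldots,n-1$. If $z\in\mathbb{C}$ is any zero of $p$, then \[|z|^2 \leq \cos^2 \frac{\pi}{n+2}+|b_{n-1}|+ \frac{1}{4} \sum_{j=0}^{n-1}|b_j|^2 + \sqrt{\sum_{j=0}^{n-1}|b_j|^2}.\] *)

(* Defs.v *)
From mathcomp Require Import all_boot all_order all_algebra.
From mathcomp Require Import complex.
From mathcomp Require Import reals trigo.

Set Implicit Arguments.
Unset Strict Implicit.
Unset Printing Implicit Defensive.

Import Order.TTheory GRing.Theory Num.Theory.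

Local Open Scope ring_scope.

(* b_j = a_(n-1) a_j - a_(j-1) with a_k := p`_k; the [if] implements the
   convention a_(-1) = 0. *)
Definition bcoef (C : nzRingType) (p : {poly C}) (n j : nat) : C :=
  p`_(n - 1) * p`_j - (if j is k.+1 then p`_k else 0).

(* Main.v *)
(** Since [(x - a_(n-1)) p(x) = x^(n+1) - \sum_j b_j x^j], a zero [z] of [p] with
    [r = |z|] satisfies [r^(n+1) <= \sum_(j < n) |b_j| r^j].  Put [t_j = r^j],
    [T = \sum_(j <= n) t_j^2] and [B^2 = \sum_j |b_j|^2].  Then
    [r T = \sum_(j < n) t_j t_(j+1) + t_n r^(n+1)], where the first term is at most
    [cos (pi / (n+2)) T] (the largest eigenvalue of the path on [n+1] vertices is
    [2 cos (pi / (n+2))]) and the second is at most [B T / 2] by Cauchy-Schwarz.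
    Hence [r <= cos (pi / (n+2)) + B / 2], and it remains to square. *)

Require Import Defs.
From mathcomp Require Import all_boot all_order all_algebra.
From mathcomp Require Import complex.
From mathcomp Require Import reals trigo.
From mathcomp Require Import ring lra.

Set Implicit Arguments.
Unset Strict Implicit.
Unset Printing Implicit Defensive.

Import Order.TTheory GRing.Theory Num.Theory.

Local Open Scope ring_scope.

Lemma sum_mul_root (C : comNzRingType) (n : nat) (p : {poly C}) (z : C) :
  (0 < n)%N -> p \is monic -> size p = n.+1 -> root p z ->
  z ^+ n.+1 = \sum_(0 <= j < n) bcoef p n j * z ^+ j.
Proof.
case: n => // n _ pm ps /rootP.
have -> : p.[z] = z ^+ n.+1 + \sum_(0 <= j < n.+1) p`_j * z ^+ j.
  rewrite horner_coef ps big_ord_recr /= big_mkord addrC.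
  by have := monicP pm; rewrite lead_coefE ps /= => ->; rewrite mul1r.
set s := \sum_(_ <= _ < _) _ => /eqP; rewrite addr_eq0 => /eqP zn.
(* The shifted coefficients [a_(j-1)] start from [a_(-1) = 0] and stop short of the top term of [s],
   hence the correction [p_n z^n]. *)
have E : \sum_(0 <= j < n.+1) bcoef p n.+1 j * z ^+ j =
    p`_n * s - z * (s - p`_n * z ^+ n).
  rewrite /bcoef subn1 /=.
  under eq_bigr do rewrite mulrBl -mulrA.
  rewrite big_split /= -mulr_sumr; congr (_ + _).
  rewrite sumrN; congr (- _).
  have -> : s - p`_n * z ^+ n = \sum_(0 <= j < n) p`_j * z ^+ j.
    by rewrite /s big_nat_recr //= addrK.
  rewrite big_nat_recl //= mul0r add0r mulr_sumr.
  by apply: eq_bigr => j _; rewrite exprS; ring.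
by rewrite E exprS zn; rewrite [z * (_ - _)]mulrBr mulrCA -exprS zn; ring.
Qed.

Lemma ler_sum_mul_succ (R : realType) (n : nat) (t : nat -> R) :
  \sum_(0 <= j < n) t j * t j.+1 <=
    cos (pi / (n + 2)%:R) * \sum_(0 <= j < n.+1) t j ^+ 2.
Proof.
set x := pi / _; set c := cos x.
have xn : x *+ n.+2 = pi.
  by rewrite -mulr_natr /x addn2 mulfVK // pnatr_eq0.
have x0 : 0 < x by rewrite divr_gt0 ?pi_gt0 // ltr0n addn2.
pose s k := sin (x *+ k).
have s_rec k : s k.+2 + s k = c * 2 * s k.+1.
  have -> : s k.+2 = sin (x *+ k.+1 + x) by rewrite -mulrSr.
  have -> : s k = sin (x *+ k.+1 - x) by rewrite mulrSr addrK.
  by rewrite sinD sinB /s -/c; ring.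
have s_gt0 k : (k <= n)%N -> 0 < s k.+1.
  move=> kn; apply: sin_gt0_pi; rewrite ?pmulrn_lgt0 //= -xn.
  by rewrite x0 ltr_pMn2l.
(* [s] is the Perron eigenvector of the path; summing the AM-GM inequalities
   [2 t_j t_(j+1) <= t_j^2 s_(j+2) / s_(j+1) + t_(j+1)^2 s_(j+1) / s_(j+2)]
   gives [2 c] in front of each [t_j^2], and the last term vanishes for [m = n]. *)
have step m : (m <= n)%N ->
    2 * \sum_(0 <= j < m) t j * t j.+1 + t m ^+ 2 * (s m.+2 / s m.+1) <=
    2 * c * \sum_(0 <= j < m.+1) t j ^+ 2.
  elim: m => [|m IH] mn.
    (* The boundary value [s 0 = sin 0 = 0] turns the recurrence into [s 2 / s 1 = 2 c]. *)
    have s1 := s_gt0 0%N isT; have := s_rec 0%N.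
    rewrite {2}/s mulr0n sin0 addr0 => ->.
    by rewrite big_geq // big_nat1 mulfK ?gt_eqF // mulr0 add0r; lra.
  have := IH (ltnW mn).
  rewrite [in X in _ -> X <= _]big_nat_recr //=.
  rewrite [in X in _ -> _ <= X]big_nat_recr //=.
  have a0 := s_gt0 m (ltnW mn); have b0 := s_gt0 m.+1 mn.
  (* The recurrence splits the weight [2 c] of vertex [m.+1] between its two edges. *)
  have -> : s m.+3 / s m.+2 = 2 * c - s m.+1 / s m.+2.
    have -> : s m.+3 = c * 2 * s m.+2 - s m.+1 by rewrite -s_rec addrK.
    by field; rewrite gt_eqF.
  have : 0 <= (t m * s m.+2 - t m.+1 * s m.+1) ^+ 2 / (s m.+1 * s m.+2).
    by rewrite divr_ge0 ?sqr_ge0 // mulr_ge0 ?ltW.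
  have -> : (t m * s m.+2 - t m.+1 * s m.+1) ^+ 2 / (s m.+1 * s m.+2) =
     t m ^+ 2 * (s m.+2 / s m.+1) + t m.+1 ^+ 2 * (s m.+1 / s m.+2)
     - 2 * (t m * t m.+1).
    by field; rewrite !gt_eqF.
  by lra.
have := step n (leqnn n).
by rewrite {1}/s xn sinpi mul0r mulr0 addr0; lra.
Qed.

(** Cauchy-Schwarz and AM-GM in one step: the difference of the two sides is a sum of squares
    divided by [B], so [B = 0], where every [u j] vanishes, is treated apart. *)
Lemma ler_mul_sum (R : rcfType) (n : nat) (u t : nat -> R) (y : R) :
  2 * (y * \sum_(0 <= j < n) u j * t j) <=
    Num.sqrt (\sum_(0 <= j < n) u j ^+ 2) *
      (y ^+ 2 + \sum_(0 <= j < n) t j ^+ 2).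
Proof.
set S := \sum_(0 <= j < n) u j ^+ 2; set B := Num.sqrt S.
have S0 : 0 <= S by apply: sumr_ge0 => j _; exact: sqr_ge0.
have B2 : B ^+ 2 = S by rewrite sqr_sqrtr.
have [B0|/negPf Bn0] := eqVneq B 0.
  have : S == 0 by rewrite -B2 B0 expr0n.
  rewrite psumr_eq0 => [/allP u0|j _]; last exact: sqr_ge0.
  rewrite B0 mul0r big1_seq ?mulr0 // => j /andP[_ /u0].
  by rewrite sqrf_eq0 => /eqP ->; rewrite mul0r.
have Bpos : 0 < B by rewrite lt_def Bn0 sqrtr_ge0.
(* Since [B^2] is the sum of the [u j ^+ 2], the term [B y^2] can be spread over the indices in
   proportion to [u j ^+ 2]. *)
have -> : B * (y ^+ 2 + \sum_(0 <= j < n) t j ^+ 2) =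
    \sum_(0 <= j < n) (y ^+ 2 / B * u j ^+ 2 + B * t j ^+ 2).
  rewrite big_split /= -!mulr_sumr -/S -B2; field.
  by rewrite Bn0.
rewrite mulrA mulr_sumr; apply: ler_sum => j _; rewrite -subr_ge0.
have -> : y ^+ 2 / B * u j ^+ 2 + B * t j ^+ 2 - 2 * y * (u j * t j) =
    (y * u j - B * t j) ^+ 2 / B by field; rewrite Bn0.
by rewrite divr_ge0 ?sqr_ge0 ?ltW.
Qed.

Lemma ler_cos_sqrt_sum (R : realType) (n : nat) (u : nat -> R) (r : R) :
  0 <= r -> r ^+ n.+1 <= \sum_(0 <= j < n) u j * r ^+ j ->
  r <= cos (pi / (n + 2)%:R) + Num.sqrt (\sum_(0 <= j < n) u j ^+ 2) / 2.
Proof.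
move=> r0 le_r.
have path := ler_sum_mul_succ n (fun j => r ^+ j).
have cs := ler_mul_sum n u (fun j => r ^+ j) (r ^+ n).
set c := cos _ in path *; set B := Num.sqrt _ in cs *.
set T := \sum_(0 <= j < n.+1) (r ^+ j) ^+ 2 in path.
(* The term [j = 0] equals 1, so this holds even for [r = 0]. *)
have T0 : 0 < T.
  rewrite /T big_nat_recl // expr0 expr1n ltr_pwDl //.
  by apply: sumr_ge0 => j _; exact: sqr_ge0.
have rT : r * T = \sum_(0 <= j < n) r ^+ j * r ^+ j.+1 + r ^+ n * r ^+ n.+1.
  rewrite -(big_nat_recr n 0 (fun j => r ^+ j * r ^+ j.+1)) //= mulr_sumr.
  by apply: eq_bigr => j _; rewrite [r ^+ _.+1]exprS; ring.
(* The choice [y = r^n] supplies exactly the last term of [T]. *)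
have Tn : r ^+ n ^+ 2 + \sum_(0 <= j < n) (r ^+ j) ^+ 2 = T.
  by rewrite /T big_nat_recr //= addrC.
rewrite Tn in cs.
have le_top := ler_wpM2l (exprn_ge0 n r0) le_r.
rewrite -(ler_pM2r T0) rT mulrDl; lra.
Qed.

Lemma normc_ge0 (R : rcfType) (x : R[i]) : 0 <= Normc.normc x.
Proof. by case: x => a b; exact: sqrtr_ge0. Qed.

Theorem corollary2p13 (R : realType) (n : nat) (p : {poly R[i]}) (z : R[i])
    (hn : (3 <= n)%N) (pmonic : p \is monic) (psize : size p = n.+1)
    (a0 : p`_0 != 0) (pz : root p z) :
  Normc.normc z ^+ 2 <=
    cos (pi / (n + 2)%:R) ^+ 2 + Normc.normc (bcoef p n (n - 1))
    + 4^-1 * (\sum_(0 <= j < n) Normc.normc (bcoef p n j) ^+ 2)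
    + Num.sqrt (\sum_(0 <= j < n) Normc.normc (bcoef p n j) ^+ 2).
Proof.
have n0 : (0 < n)%N by apply: leq_trans hn.
set u := fun j => Normc.normc (bcoef p n j).
set r := Normc.normc z.
have r0 : 0 <= r by exact: normc_ge0.
have le_r : r ^+ n.+1 <= \sum_(0 <= j < n) u j * r ^+ j.
  (* Embedded in [R[i]], [r] is the norm of [z], so the triangle inequality applies to the identity
     for [z^(n+1)]. *)
  rewrite -lecR rmorphXn rmorph_sum /= -[(r%:C)%C]/`|z| -normrX.
  rewrite (sum_mul_root n0 pmonic psize pz).
  apply: le_trans (ler_norm_sum _ _ _) _.
  apply: ler_sum => j _.
  by rewrite normrM normrX rmorphM rmorphXn.
have le_rc := ler_cos_sqrt_sum r0 le_r.
set S := \sum_(0 <= j < n) u j ^+ 2 in le_rc *.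
have S0 : 0 <= S by apply: sumr_ge0 => j _; exact: sqr_ge0.
have B2 := sqr_sqrtr S0; have B0 := sqrtr_ge0 S.
have c1 := cos_le1 (pi / (n + 2)%:R : R).
have b0 : 0 <= u (n - 1)%N by exact: normc_ge0.
set c := cos _ in le_rc c1 *.
have le_r2 : r ^+ 2 <= (c + Num.sqrt S / 2) ^+ 2.
  by rewrite lerXn2r // nnegrE (le_trans r0).
apply: le_trans le_r2 _; rewrite -/S -[Normc.normc (bcoef _ _ _)]/(u (n - 1)%N).
(* With [B] the root of [S], the square is [c^2 + c B + S / 4]; now [c B <= B] and
   [0 <= u (n - 1)]. *)
have := ler_wpM2r B0 c1; rewrite mul1r -{2}B2; nra.
Qed.
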